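(* For every infinite-dimensional Banach space $Z$ and for every continuous linear projector $P:Z\to Z$ with $\dim\mathrm{Ker}(P)=1$ there exist an infinite-dimensional convex compact subset $C\subset Z$ and an inner point $z\in C$ such that the restriction $P|_C:C\to P(C)$ is not open at $z$. Moreover, the inverse multivalued mapping $(P|_C)^{-1}:P(C)\to C$ admits no continuous selection over any neighborhood of the point $P(z)$; that is, for every open neighborhood $U$ of $P(z)$ there is no continuous map $s:U\cap P(C)\to C$ with $P(s(y))=y$ for all $y\in U\cap P(C)$.
   Context: Banach spaces are over $\mathbb R$. A projector is a linear map $P$ with $P\circ P=P$. A point $m$ of a convex set $M$ is an inner point (in the convex sense) of $M$ if for each $x\in M$, $x\ne m$, there exists $y\in M$ such that $m\in[x;y)$, where $[x;y)$ is the segment $[x,y]$ without the end point $y$. A convex set is infinite-dimensional if its affine hull is infinite-dimensional. The map $P|_C:C\to P(C)$ is open at $z$ if for every neighborhood $V$ of $z$ in $C$ the image $P(V)$ is a neighborhood of $P(z)$ in $P(C)$ (subspace topologies). The multivalued mapping $(P|_C)^{-1}$ sends $y\in P(C)$ to $\{c\in C: P(c)=y\}$. *)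

(* Defs.v *)
From HB Require Import structures.
From mathcomp Require Import all_boot all_order all_algebra.
From mathcomp Require Import all_classical all_reals all_analysis.

Set Implicit Arguments.
Unset Strict Implicit.
Unset Printing Implicit Defensive.

Import Order.TTheory GRing.Theory Num.Theory.
Import numFieldNormedType.Exports.

Local Open Scope classical_set_scope.
Local Open Scope ring_scope.

Section LinearAlgebra.
Context {R : realType} {E : lmodType R}.
Implicit Types (A V : set E) (x y : E) (n : nat).

Definition lspan n (e : 'I_n -> E) : set E :=
  [set x | exists a : 'I_n -> R, x = \sum_(i < n) a i *: e i].

Definition lin_indep n (e : 'I_n -> E) : Prop :=
  forall a : 'I_n -> R, \sum_(i < n) a i *: e i = 0 -> forall i, a i = 0.

Definition has_dim n V : Prop :=
  exists2 e : 'I_n -> E, lin_indep e & V = lspan e.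

(* Meant for linear subspaces, where "contained in the span of a finite family"
   and "spanned by a finite family" agree; with the inclusion the empty set does
   not count as infinite-dimensional. *)
Definition infinite_dim V : Prop :=
  forall n (e : 'I_n -> E), ~ V `<=` lspan e.

Definition is_affine A : Prop :=
  forall x y (t : R), A x -> A y -> A ((1 - t) *: x + t *: y).

Definition affine_hull A : set E := smallest is_affine A.

Definition direction A : set E := [set v | exists2 x, A x & exists2 y, A y & v = x - y].

Definition infinite_dim_convex A : Prop := infinite_dim (direction (affine_hull A)).

Definition segment x y : set E :=
  [set w | exists2 t : R, 0 <= t <= 1 & w = (1 - t) *: x + t *: y].

Definition segment_co x y : set E := segment x y `\ y.

Definition inner_point A (m : E) : Prop :=
  A m /\ forall x, A x -> x <> m -> exists2 y, A y & segment_co x y m.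

Definition ker (f : E -> E) : set E := [set x | f x = 0].

End LinearAlgebra.

(* Neighbourhoods of a point of C in the subspace C are the subsets of C that
   belong to the filter [within C (nbhs z)]. *)
Definition open_at {S T : topologicalType} (C : set S) (f : S -> T) (z : S) : Prop :=
  forall V : set S, V `<=` C -> within C (nbhs z) V ->
    within (f @` C) (nbhs (f z)) (f @` V).

(* The map s is total for convenience; only its restriction to D matters. *)
Definition continuous_selection {S T : topologicalType} (D : set T) (C : set S)
    (f : S -> T) (s : T -> S) : Prop :=
  [/\ {within D, continuous s}, forall y, D y -> C (s y)
    & forall y, D y -> f (s y) = y].

(* Main.v *)
Require Import Defs.
From HB Require Import structures.
From mathcomp Require Import all_boot all_order all_algebra.
From mathcomp Require Import all_classical all_reals all_analysis.
From mathcomp Require Import ring lra.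

Set Implicit Arguments.
Unset Strict Implicit.
Unset Printing Implicit Defensive.

Import Order.TTheory GRing.Theory Num.Theory.
Import numFieldNormedType.Exports.

Local Open Scope classical_set_scope.
Local Open Scope ring_scope.

(** Let [e] span the kernel of [P] and let [y n] be vectors of the range of [P]
    tending to 0. The set [C] is the closed convex hull of [e], [-e] and all
    [e + y n], [-(e + y n)]. It is symmetric, so its centre 0 is an inner point.
    If every point of [C] above [y n] is [e + y n], then by symmetry the only
    point of [C] above [- y n] is [-(e + y n)]. Both [y n] and [- y n] tend to
    0 = P 0, yet the points above them tend to [e] and to [-e]. So points near 0
    do not project onto a neighbourhood of 0 in [P(C)], and a continuous
    selection near 0 would take both values [e] and [-e] at 0.

    Two things must be arranged. For uniqueness of the fibres, the [y n] have to
    be independent in a strong sense: a vanishing series with bounded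
    coefficients has zero coefficients. The range of [P] is infinite-dimensional
    ([infinite_dim_range]), so it contains a linearly independent sequence, and
    multiplying it by positive scalars that decrease fast enough gives strong
    independence ([bounded_free_scaling]).

    For compactness, the general point of the hull is
    [sum a k *: (e + y k) + a' *: e] with [sum |a k| + |a'| <= 1]. Written as
    [b *: e + sum a k *: y k] with [b = sum a k + a'], its coefficients [(b, a)]
    run through a set [hull_coefs] that is closed in a product of intervals, and
    the point depends continuously on them ([hull_coefs_compact],
    [hull_map_continuous]). Over [y n] strong independence forces [a] to be the
    unit vector [n], and then the norm condition forces [b = 1]
    ([hull_fibre_over_unit]). *)

(** * Linearly independent sequences *)

(** The coordinates of [m > n] vectors on [n] generators form a matrix with more
    rows than columns; a nonzero row in its left kernel is a linear relation. *)
Lemma lin_indep_lspan_bound {R : realType} {E : lmodType R} m n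
    (y : 'I_m -> E) (e : 'I_n -> E) :
  lin_indep y -> (forall k, lspan e (y k)) -> (m <= n)%N.
Proof.
move=> yfree /choice[A yE]; rewrite leqNgt; apply/negP => nm.
pose M := \matrix_(k < m, i < n) A k i.
have : kermx M != 0.
  by rewrite kermx_eq0 -row_leq_rank -ltnNge (leq_ltn_trans (rank_leq_col _)).
case/rowV0Pn => c /sub_kermxP cM /eqP; apply; apply/rowP => k.
rewrite mxE; apply: (yfree (c 0)).
under eq_bigr do rewrite yE scaler_sumr.
rewrite exchange_big big1 //= => i _.
under eq_bigr do rewrite scalerA.
rewrite -scaler_suml; move/rowP/(_ i): cM; rewrite !mxE => cMi.
by rewrite (eq_bigr (fun k => c 0 k * M k i)) ?cMi ?scale0r // => j _; rewrite mxE.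
Qed.

Lemma infinite_dim_free_seq {R : realType} {E : lmodType R} (V : set E) (y : nat -> E) :
  (forall n, lin_indep (fun i : 'I_n => y i)) -> (forall k, V (y k)) ->
  infinite_dim V.
Proof.
move=> yfree Vy n e Ve.
have := lin_indep_lspan_bound (yfree n.+1) (fun k => Ve _ (Vy k)).
by rewrite ltnn.
Qed.

Lemma notin_prefix_span_free {R : realType} {E : lmodType R} (y : nat -> E) :
  (forall n, ~ lspan (fun i : 'I_n => y i) (y n)) ->
  forall n, lin_indep (fun i : 'I_n => y i).
Proof.
move=> yout; elim=> [|n IHn] a; first by move=> _ [].
rewrite big_ord_recr /=; have [amax0 | an0] := eqVneq (a ord_max) 0.
  rewrite amax0 scale0r addr0 => /(IHn (a \o widen_ord (leqnSn n))) /= a0 i.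
  have := ltn_ord i; rewrite ltnS leq_eqVlt => /predU1P[iE|ilt].
    by rewrite (_ : i = ord_max) //; exact: val_inj.
  by rewrite -(a0 (Ordinal ilt)); congr a; exact: val_inj.
move=> /eqP; rewrite addrC addr_eq0 => /eqP yE; case: (yout n).
exists (fun i => - ((a ord_max)^-1 * a (widen_ord (leqnSn n) i))).
rewrite -[LHS]scale1r -(mulVf an0) -scalerA yE scalerN scaler_sumr -sumrN.
by apply: eq_bigr => i _; rewrite scaleNr scalerA.
Qed.

(** Choose each term outside the span of the finitely many previous ones. *)
Lemma infinite_dim_has_free_seq {R : realType} {E : lmodType R} (V : set E) :
  infinite_dim V ->
  exists2 y : nat -> E, (forall k, V (y k)) &
    forall n, lin_indep (fun i : 'I_n => y i).
Proof.
move=> Vinf.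
have /choice[step] : forall nw : nat * (nat -> E), exists u,
    V u /\ ~ lspan (fun i : 'I_nw.1 => nw.2 i) u.
  move=> [n w]; have /existsNP[u /not_implyP uP] := Vinf n (fun i => w i).
  by exists u.
move=> stepP.
(* [W n] agrees with the sequence under construction at the indices below [n];
   building prefixes makes all previous terms available at each step. *)
pose W := fix W n : nat -> E := if n is m.+1
  then (fun i => if (i < m)%N then W m i else step (m, W m)) else (fun=> 0).
have WE n i : (i < n)%N -> W n i = W i.+1 i.
  elim: n => // n IHn; rewrite ltnS leq_eqVlt => /predU1P[->//|ltin].
  by rewrite /= ltin ltnn IHn //= ltnn.
exists (fun k => W k.+1 k) => [k|].
  by rewrite /= ltnn; exact: (stepP (k, W k)).1.
apply: (@notin_prefix_span_free _ _ (fun k => W k.+1 k)) => n; rewrite /= ltnn.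
have := (stepP (n, W n)).2; congr (~ (lspan _ _)); apply/funext => i /=.
by rewrite WE //= ltnn.
Qed.

(** Since [x = (x - P x) + P x], finite generating families of the kernel and of
    the range together generate the whole space. *)
Lemma infinite_dim_range {R : realType} {E : lmodType R} (P : {linear E -> E}) n :
  infinite_dim [set: E] -> P \o P =1 P -> has_dim n (ker P) ->
  infinite_dim (range P).
Proof.
move=> Einf PP [f _ kerE] m e Pe.
pose g := fun i : 'I_(m + n) => match fintype.split i with inl j => e j | inr k => f k end.
apply: (Einf _ g) => x _.
have [a PxE] : lspan e (P x) by apply: Pe; exists x.
have [b rE] : lspan f (x - P x).
  by rewrite -kerE /ker /= linearB /= -[P (P x)]/((P \o P) x) PP subrr.
exists (fun i => match fintype.split i with inl j => a j | inr k => b k end).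
rewrite big_split_ord /= -[LHS](subrK (P x)) rE [in LHS]PxE addrC.
congr (_ + _); apply: eq_bigr => i _; rewrite /g.
  by rewrite -[rshift m i]/(unsplit (inr i)) unsplitK.
by rewrite -[lshift n i]/(unsplit (inl i)) unsplitK.
Qed.

(** On the compact unit sphere of the coefficients, the norm of the combination
    is continuous and nowhere zero, hence bounded below; homogeneity extends the
    bound to all coefficients. *)
Lemma lin_indep_norm_bound {R : realType} {E : normedModType R} n (y : 'I_n -> E) :
  lin_indep y ->
  exists2 g : R, 0 < g &
    forall (c : 'I_n -> R) i, g * `|c i| <= `|\sum_(j < n) c j *: y j|.
Proof.
move=> yfree; pose S (c : 'rV[R]_n) := \sum_j c 0 j *: y j.
pose A : set 'rV[R]_n := [set c | `|c| = 1].
have Scont : continuous (fun c => `|S c|).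
  move=> c; apply: (@continuous_comp _ _ _ S); last exact: norm_continuous.
  move: c; apply: continuous_big => [|j _ c]; first exact: add_continuous.
  by apply: cvgZr_tmp; [exact: (@nbhs_filter _ c)|exact: coord_continuous].
have coef_le (c : 'rV[R]_n) i : `|c 0 i| <= `|c|.
  rewrite [leRHS]/Num.norm /= mx_normrE.
  by apply: (le_bigmax _ (fun ij => `|c ij.1 ij.2|) (0, i)).
have Acompact : compact A.
  apply: bounded_closed_compact.
    by exists 1; split => // M M1 c /= ->; exact: ltW.
  apply: (@preimage_closed _ _ (fun c : 'rV[R]_n => `|c|) [set 1]).
    by move=> c _; exact: norm_continuous.
  exact: closed_eq.
suff [g g0 gP] : exists2 g : R, 0 < g & forall c, A c -> g <= `|S c|.
  exists g => // c i; pose r := \row_j c j.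
  have SE : \sum_(j < n) c j *: y j = S r.
    by apply: eq_bigr => j _; rewrite mxE.
  have ci : `|c i| <= `|r| by have := coef_le r i; rewrite mxE.
  rewrite SE (le_trans (ler_wpM2l (ltW g0) ci))//.
  have [->|r0] := eqVneq r 0; first by rewrite normr0 mulr0.
  have nr0 : 0 < `|r| by rewrite normr_gt0.
  rewrite -ler_pdivlMr //; have Ar : A (`|r|^-1 *: r).
    by rewrite /A /= normrZ normfV normr_id mulVf // gt_eqF.
  rewrite (le_trans (gP _ Ar)) // /S mulrC.
  under eq_bigr do rewrite mxE -scalerA.
  by rewrite -scaler_sumr normrZ normfV normr_id.
have [A0|/set0P/negP/negPn/eqP A0] := pselect (A !=set0); last first.
  by exists 1 => // c; rewrite A0.
have [c Ac cmin] := EVT_min_rV A0 Acompact (continuous_subspaceT Scont).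
exists `|S c|; last by move=> d Ad; apply: cmin; rewrite inE.
rewrite normr_gt0; apply/eqP => Sc0; move: Ac; rewrite inE /A /=.
rewrite (_ : c = 0) ?normr0; last by apply/rowP => i; rewrite mxE (yfree (c 0)).
by move/esym/eqP; rewrite oner_eq0.
Qed.

(** * Dyadically dominated series and strong independence *)

Lemma dyadic_tail {R : realType} {E : normedModType R} (u : nat -> E) (M : R) n :
  (forall k, (n <= k)%N -> `|u k| <= M * 2^-1 ^+ k.+1) ->
  forall m, (n <= m)%N -> `|series u m - series u n| <= M * 2^-1 ^+ n.
Proof.
move=> uM m nm.
have M0 : 0 <= M.
  have := le_trans (normr_ge0 _) (uM _ (leqnn n)).
  by rewrite pmulr_lge0 // exprn_gt0 // invr_gt0.
(* The exact remainder of the geometric series is what an induction on [m]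
   can carry. *)
suff : `|series u m - series u n| <= M * 2^-1 ^+ n - M * 2^-1 ^+ m.
  by move=> /le_trans; apply; rewrite lerBlDr lerDl mulr_ge0 // exprn_ge0 // invr_ge0.
elim: m nm => [|m IHm]; first by rewrite leqn0 => /eqP->; rewrite !subrr normr0.
rewrite leq_eqVlt => /predU1P[->|]; first by rewrite !subrr normr0.
rewrite ltnS => nm.
have -> : series u m.+1 - series u n = (series u m - series u n) + u m.
  by rewrite [series u m.+1]seriesSr addrAC.
rewrite (le_trans (ler_normD _ _)) // (le_trans (lerD (IHm nm) (uM _ nm))) //.
rewrite -addrA lerD2l exprS; lra.
Qed.

Lemma dyadic_series_cvg {R : realType} {E : completeNormedModType R} (u : nat -> E) (M : R) :
  (forall k, `|u k| <= M * 2^-1 ^+ k.+1) -> cvgn (series u).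
Proof.
move=> uM; apply: normed_cvg.
have geoE k : M * 2^-1 ^+ k.+1 = geometric (M / 2) 2^-1 k by rewrite /= exprS mulrA.
apply: (@series_le_cvg _ _ (geometric (M / 2) 2^-1)) => [k|k|k|] //=.
- by have := uM k; rewrite geoE => /(le_trans _); apply.
- by rewrite (le_trans (uM k)) ?geoE.
- by apply: is_cvg_geometric_series; rewrite ger0_norm; lra.
Qed.

Lemma dyadic_limit_tail {R : realType} {E : normedModType R} (u : nat -> E) (l : E) (M : R) n :
  (forall k, (n <= k)%N -> `|u k| <= M * 2^-1 ^+ k.+1) ->
  series u @ \oo --> l -> `|l - series u n| <= M * 2^-1 ^+ n.
Proof.
move=> uM ul.
have : `|series u m - series u n| @[m --> \oo] --> `|l - series u n|.
  by apply: cvg_norm; apply: cvgB => //; exact: cvg_cst.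
move/cvgr_to_le; apply; near=> m; apply: dyadic_tail => //.
by near: m; exact: nbhs_infty_ge.
Unshelve. all: by end_near. Qed.

Lemma prod_le_factor {R : realType} (h : nat -> R) n k :
  (forall j, 0 <= h j <= 1) -> (n <= k)%N -> \prod_(j < k.+1) h j <= h n.
Proof.
move=> h01; rewrite -ltnS => nk; rewrite (bigD1 (Ordinal nk)) //=.
by rewrite ler_piMr ?(andP (h01 n)).1 // prodr_ile1.
Qed.

(** The scalars have to beat the constants [g n] that bound the first [n]
    coefficients of a combination of [y 0, ..., y (n-1)] by its norm. If
    [sum d k *: (lam k *: y k) = 0], the partial sum of order [n] is the opposite
    of a tail, and [lam] is so small beyond [n] that this tail is at most
    [M * g n / (n + 1)]. So [|d i * lam i| <= M / (n + 1)] for each [i] and all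
    [n > i]. Mere linear independence of [y] suffices because the bound at stage
    [n] constrains only the later scalars. *)
Lemma bounded_free_scaling {R : realType} {E : normedModType R} (y : nat -> E) :
  (forall n, lin_indep (fun i : 'I_n => y i)) ->
  exists lam : nat -> R,
    [/\ forall k, 0 < lam k, forall k, `|lam k *: y k| <= 2^-1 ^+ k.+1
      & forall (d : nat -> R) M, (forall k, `|d k| <= M) ->
        series (fun k => d k *: (lam k *: y k)) @ \oo --> 0 ->
        forall k, d k = 0].
Proof.
move=> yfree.
have /choice[g gP] : forall n, exists g : R, 0 < g /\ forall (c : 'I_n -> R) i,
    g * `|c i| <= `|\sum_(j < n) c j *: y j|.
  by move=> n; have [g] := lin_indep_norm_bound (yfree n); exists g.
pose h n := Num.min 1 (g n) / n.+1%:R.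
have h0 n : 0 < h n by rewrite divr_gt0 ?ltr0n // lt_min ltr01 (gP n).1.
have h1 n : 0 <= h n <= 1.
  by rewrite ltW //= ler_pdivrMr ?ltr0n // mul1r ge_min ler1n.
have hg n : h n * n.+1%:R <= g n.
  by rewrite divfK ?pnatr_eq0 // ge_min lexx orbT.
(* The product makes the terms from [n] on smaller than [h n], for every [n]. *)
pose lam k := 2^-1 ^+ k.+1 * \prod_(j < k.+1) h j / (1 + `|y k|).
have y1 k : 0 < 1 + `|y k| by rewrite ltr_pwDl.
have lam0 k : 0 < lam k.
  by rewrite divr_gt0 // mulr_gt0 ?exprn_gt0 ?invr_gt0 // prodr_gt0.
have lamP n k : (n <= k)%N -> `|lam k *: y k| <= h n * 2^-1 ^+ k.+1.
  move=> nk; rewrite normrZ gtr0_norm // [leRHS]mulrC /lam.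
  rewrite mulrAC ler_pdivrMr // ler_pM ?mulr_ge0 ?exprn_ge0 ?invr_ge0 //.
  - by apply: prodr_ge0 => j _; exact: ltW.
  - by rewrite ler_wpM2l ?exprn_ge0 ?invr_ge0 // prod_le_factor.
  - by rewrite lerDr.
exists lam; split=> // [k|d M dM d0 i].
  rewrite (le_trans (lamP k k _)) // ler_piMl ?exprn_ge0 ?invr_ge0 //.
  by case/andP: (h1 k).
have M0 : 0 <= M by rewrite (le_trans _ (dM 0%N)).
have coef_small n : (i < n)%N -> `|d i * lam i| * n.+1%:R <= M.
  move=> i_n.
  have gle : g n * `|d i * lam i| <= `|\sum_(j < n) d j *: (lam j *: y j)|.
    under eq_bigr do rewrite scalerA.
    exact: ((gP n).2 (fun j => d j * lam j) (Ordinal i_n)).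
  have tail : `|0 - series (fun k => d k *: (lam k *: y k)) n| <= M * h n * 2^-1 ^+ n.
    apply: dyadic_limit_tail => // k nk; rewrite normrZ -mulrA.
    by rewrite ler_pM // lamP.
  rewrite sub0r normrN seriesEord /= in tail.
  have {gle tail}le_tail : g n * `|d i * lam i| <= M * h n.
    rewrite (le_trans gle) // (le_trans tail) // ler_piMr //.
      by rewrite mulr_ge0 // ltW.
    by apply: exprn_ile1; lra.
  rewrite -(ler_pM2l (h0 n)) mulrCA [leRHS]mulrC (le_trans _ le_tail) //.
  by rewrite mulrC ler_wpM2r.
have /eqP : d i * lam i == 0.
  rewrite -normr_eq0 eq_le normr_ge0 andbT leNgt; apply/negP => dpos.
  pose n := maxn i.+1 (Num.bound (M / `|d i * lam i|)).
  have /coef_small : (i < n)%N by rewrite leq_maxl.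
  rewrite mulrC -ler_pdivlMr // leNgt => /negP; apply.
  rewrite (lt_le_trans (archi_boundP _)) ?divr_ge0 // ler_nat.
  by rewrite (leq_trans (leq_maxr i.+1 _)).
by move=> /eqP; rewrite mulf_eq0 (gt_eqF (lam0 i)) orbF => /eqP.
Qed.

(** * The compact set of coefficients *)

(** The sequences carry the product topology, not a norm: this is what makes the
    coefficient set compact. *)
Definition coef_space (R : realType) : topologicalType :=
  (R * prod_topology (fun _ : nat => R))%type.

(** These are the pairs [(b, a)] with [sum |a k| + |b - sum a k| <= 1]. The
    conditions on partial sums get stronger with [n], by the triangle inequality,
    and each of them is closed in the product topology because it involves
    finitely many coordinates. *)
Definition hull_coefs (R : realType) : set (coef_space R) :=
  [set p : coef_space R | forall n, \sum_(k < n) `|p.2 k| + `|p.1 - \sum_(k < n) p.2 k| <= 1].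

Definition hull_map {R : realType} {E : completeNormedModType R}
    (e : E) (y : nat -> E) (p : coef_space R) : E :=
  p.1 *: e + limn (series (fun k => p.2 k *: y k)).

(** The coefficients of [e + y n]. *)
Definition unit_coefs {R : realType} (n : nat) : coef_space R :=
  (1, fun k => (k == n)%:R).

Definition comb_coefs {R : realType} (s t : R) (p q : coef_space R) : coef_space R :=
  (s * p.1 + t * q.1, fun k => s * p.2 k + t * q.2 k).

Lemma hull_coefs_bound (R : realType) (p : coef_space R) :
  hull_coefs p -> `|p.1| <= 1 /\ forall k, `|p.2 k| <= 1.
Proof.
move=> pK; split=> [|k]; first by have := pK 0%N; rewrite !big_ord0 add0r subr0.
apply: le_trans (pK k.+1); rewrite big_ord_recr /= addrAC lerDr.
by rewrite addr_ge0 // sumr_ge0.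
Qed.

Lemma hull_coefs_compact (R : realType) : compact (@hull_coefs R).
Proof.
pose box : set (coef_space R) :=
  `[-1, 1] `*` [set a : nat -> R | forall k, `[-1, 1]%classic (a k)].
apply: (@subclosed_compact _ _ box); last 2 first.
- have cube : @compact (prod_topology (fun _ : nat => R))
      [set a | forall k, `[-1, 1]%classic (a k)].
    exact: (tychonoff (fun k : nat => @segment_compact R (-1) 1)).
  exact: (compact_setX (@segment_compact _ (-1) 1) cube).
- move=> p /hull_coefs_bound[p1 p2]; split=> /= [|k];
    by rewrite in_itv /= -ler_norml.
have coef_cont k : continuous (fun p : coef_space R => p.2 k).
  move=> p; apply: (@continuous_comp (coef_space R) (prod_topology (fun _ : nat => R)) R
    snd (fun a => a k)); first exact: cvg_snd.
  exact: (@proj_continuous nat (fun=> R) k).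
pose f n (p : coef_space R) := \sum_(k < n) `|p.2 k| + `|p.1 - \sum_(k < n) p.2 k|.
have f_cont n : continuous (f n).
  move=> p; apply: (@cvgD _ _ _ (nbhs p)).
    move: p; apply: continuous_big => [|k _ p]; first exact: add_continuous.
    by apply: (@cvg_norm _ _ _ (nbhs p)); exact: coef_cont.
  apply: (@cvg_norm _ _ _ (nbhs p)); apply: (@cvgB _ _ _ (nbhs p)).
    exact: (@cvg_fst _ _ (nbhs p.1)).
  move: p; apply: continuous_big => [|k _]; first exact: add_continuous.
  exact: coef_cont.
have -> : @hull_coefs R = \bigcap_n (f n @^-1` [set x : R | x <= 1]).
  by apply/seteqP; split=> p pK n; [move=> _; exact: pK | exact: (pK n)].
apply: closed_bigI => n _; apply: preimage_closed; last exact: closed_le.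
by move=> p _; exact: f_cont.
Qed.

Lemma hull_coefs_unit (R : realType) n : hull_coefs (@unit_coefs R n).
Proof.
move=> m; rewrite /= (eq_bigr (fun k : 'I_m => ((k : nat) == n)%:R)); last first.
  by move=> k _; rewrite normr_nat.
have [nm|mn] := ltnP n m.
  rewrite (bigD1 (Ordinal nm)) //= eqxx big1 ?addr0 ?subrr ?normr0 ?addr0 // => k.
  by rewrite -val_eqE /= => /negPf->.
rewrite big1 ?add0r ?subr0 ?normr1 // => k _.
by rewrite ltn_eqF // (leq_trans (ltn_ord k)).
Qed.

Lemma hull_coefs_pole (R : realType) : hull_coefs ((1, fun=> 0) : coef_space R).
Proof. by move=> m; rewrite /= !big1 ?normr0 // add0r subr0 normr1. Qed.

(** When [a] is a unit vector it exhausts the norm budget, so nothing is left for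
    [b - sum a k]. *)
Lemma hull_coefs_unit_uniq (R : realType) (p : coef_space R) n :
  hull_coefs p -> (forall k, p.2 k = (k == n)%:R) -> p.1 = 1.
Proof.
move=> pK pE; have := pK n.+1.
have -> : \sum_(k < n.+1) `|p.2 k| = 1.
  rewrite big_ord_recr /= pE eqxx normr1 big1 ?add0r // => k _.
  by rewrite pE ltn_eqF ?normr0.
have -> : \sum_(k < n.+1) p.2 k = 1.
  rewrite big_ord_recr /= pE eqxx big1 ?add0r // => k _.
  by rewrite pE ltn_eqF.
by rewrite gerDl normr_le0 subr_eq0 => /eqP.
Qed.

(** For [0 <= s <= 1] and [t = 1 - s] this is convexity, for [(s, t) = (-1, 0)] symmetry. *)
Lemma hull_coefs_comb (R : realType) (s t : R) (p q : coef_space R) :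
  hull_coefs p -> hull_coefs q -> `|s| + `|t| <= 1 ->
  hull_coefs (comb_coefs s t p q).
Proof.
move=> pK qK st n /=; rewrite big_split /= -!mulr_sumr.
set P := \sum_(k < n) p.2 k; set Q := \sum_(k < n) q.2 k.
have -> : s * p.1 + t * q.1 - (s * P + t * Q) = s * (p.1 - P) + t * (q.1 - Q) by ring.
apply: le_trans st; apply: (@le_trans _ _
  (`|s| * (\sum_(k < n) `|p.2 k| + `|p.1 - P|) +
   `|t| * (\sum_(k < n) `|q.2 k| + `|q.1 - Q|))).
  rewrite [`|s| * (_ + _)]mulrDr [`|t| * (_ + _)]mulrDr addrACA lerD //.
    rewrite !mulr_sumr -big_split /= ler_sum // => k _.
    by rewrite (le_trans (ler_normD _ _)) // !normrM.
  by rewrite (le_trans (ler_normD _ _)) // !normrM.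
by rewrite lerD // ler_piMr.
Qed.

(** * The closed convex hull as an image of the coefficients *)

Section HullMap.
Context {R : realType} {E : completeNormedModType R} (e : E) (y : nat -> E)
  (y_small : forall k, `|y k| <= 2^-1 ^+ k.+1).

Lemma bounded_coef_dyadic (a : nat -> R) M : (forall k, `|a k| <= M) ->
  forall k, `|a k *: y k| <= M * 2^-1 ^+ k.+1.
Proof. by move=> aM k; rewrite normrZ ler_pM. Qed.

Lemma hull_series_cvg (p : coef_space R) : hull_coefs p ->
  series (fun k => p.2 k *: y k) @ \oo --> limn (series (fun k => p.2 k *: y k)).
Proof.
move=> /hull_coefs_bound[_ p1].
exact: dyadic_series_cvg (bounded_coef_dyadic p1).
Qed.

Lemma hull_map_comb (s t : R) (p q : coef_space R) :
  hull_coefs p -> hull_coefs q ->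
  hull_map e y (comb_coefs s t p q) = s *: hull_map e y p + t *: hull_map e y q.
Proof.
move=> pK qK; rewrite /hull_map !scalerDr addrACA !scalerA -scalerDl.
congr (_ + _); apply: cvg_lim => //.
have -> : series (fun k => (comb_coefs s t p q).2 k *: y k) =
    (s \*: series (fun k => p.2 k *: y k)) + (t \*: series (fun k => q.2 k *: y k)).
  apply/funext => n; rewrite seriesEord /= !fctE !seriesEord /= !scaler_sumr.
  by rewrite -big_split /=; apply: eq_bigr => k _; rewrite scalerDl !scalerA.
by apply: cvgD; apply: cvgZl_tmp; exact: hull_series_cvg.
Qed.

Lemma unit_series_cvg n : series (fun k => (k == n)%:R *: y k) @ \oo --> y n.
Proof.
apply: cvg_near_cst; exists n.+1 => // m /= nm.
rewrite seriesEord /= (bigD1 (Ordinal nm)) //= eqxx scale1r big1 ?addr0 // => k.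
by rewrite -val_eqE /= => /negPf->; rewrite scale0r.
Qed.

Lemma hull_map_unit n : hull_map e y (unit_coefs n) = e + y n.
Proof.
rewrite /hull_map /= scale1r; congr (_ + _); apply: cvg_lim => //.
exact: unit_series_cvg.
Qed.

Lemma hull_map_pole : hull_map e y (1, fun=> 0) = e.
Proof.
rewrite /hull_map /= scale1r [X in _ + X](_ : _ = 0) ?addr0 //.
apply: cvg_lim => //; apply: cvg_near_cst; exists 0%N => // m _.
by rewrite seriesEord /= big1 // => k _; rewrite scale0r.
Qed.

(** The coefficients are bounded by 1 on [hull_coefs], so the partial sums, which
    depend on finitely many coordinates, converge uniformly there. *)
Lemma hull_map_continuous : {within @hull_coefs R, continuous (hull_map e y)}.
Proof.
apply/subspace_continuousP => p pK.
pose F n (q : coef_space R) := q.1 *: e + \sum_(k < n) q.2 k *: y k.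
have Fcont n : continuous (F n).
  move=> q; apply: (@cvgD _ _ _ (nbhs q)).
    by apply: (@cvgZr_tmp _ _ _ (nbhs q)); exact: (@cvg_fst _ _ (nbhs q.1)).
  move: q; apply: continuous_big => [|k _ q]; first exact: add_continuous.
  apply: (@cvgZr_tmp _ _ _ (nbhs q)).
  apply: (@continuous_comp (coef_space R) (prod_topology (fun _ : nat => R)) R
    snd (fun a => a k)).
    exact: cvg_snd.
  exact: (@proj_continuous nat (fun=> R) k).
have Fapprox n q : hull_coefs q -> `|hull_map e y q - F n q| <= 2^-1 ^+ n.
  move=> qK; have -> : hull_map e y q - F n q =
      limn (series (fun k => q.2 k *: y k)) - series (fun k => q.2 k *: y k) n.
    by rewrite /hull_map /F seriesEord /= opprD addrACA subrr add0r.
  rewrite -[leRHS]mul1r; apply: dyadic_limit_tail; last exact: hull_series_cvg.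
  by move=> k _; apply: bounded_coef_dyadic; exact: (hull_coefs_bound qK).2.
apply/cvgrPdist_le => eps eps0; have eps30 : 0 < eps / 3 by rewrite divr_gt0.
have [n nP] : exists n, 2^-1 ^+ n <= eps / 3.
  have /cvgrPdist_le/(_ _ eps30)[n _ /(_ n (leqnn n))] : 2^-1 ^+ n @[n --> \oo] --> (0 : R).
    by apply: cvg_expr; rewrite ger0_norm; lra.
  rewrite /= sub0r normrN => le_n; exists n; exact: le_trans (ler_norm _) le_n.
have /cvgrPdist_le/(_ _ eps30) Fnear := Fcont n p.
rewrite near_withinE; near=> q => qK.
have -> : hull_map e y p - hull_map e y q =
    (hull_map e y p - F n p) + (F n p - F n q) - (hull_map e y q - F n q).
  by rewrite addrA subrK opprB addrA subrK.
have Fpq : `|F n p - F n q| <= eps / 3 by near: q.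
rewrite (le_trans (ler_normB _ _)) //.
have := ler_normD (hull_map e y p - F n p) (F n p - F n q).
have := Fapprox n p pK; have := Fapprox n q qK; lra.
Unshelve. all: by end_near. Qed.

End HullMap.

(** * The fibres of the projection *)

(** Projecting a hull point removes its component along [e] and keeps the series;
    strong independence then identifies the coefficients of the series. *)
Lemma hull_fibre_over_unit {R : realType} {Z : completeNormedModType R}
    (P : {linear Z -> Z}) (e : Z) (y : nat -> Z) :
  continuous P -> P e = 0 -> (forall k, P (y k) = y k) ->
  (forall k, `|y k| <= 2^-1 ^+ k.+1) ->
  (forall (d : nat -> R) M, (forall k, `|d k| <= M) ->
     series (fun k => d k *: y k) @ \oo --> 0 -> forall k, d k = 0) ->
  forall n x, (hull_map e y @` @hull_coefs R) x -> P x = y n -> x = e + y n.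
Proof.
move=> Pcont Pe Py ysmall yfree n _ [p pK <-].
have cvgS := hull_series_cvg ysmall pK.
set l := limn _ in cvgS.
have Pl : P l = l.
  suff cvgP : series (fun k => p.2 k *: y k) m @[m --> \oo] --> P l.
    exact: (cvg_unique (@norm_hausdorff _ Z) cvgP cvgS).
  have : P (series (fun k => p.2 k *: y k) m) @[m --> \oo] --> P l.
    exact: (cvg_comp _ _ cvgS (Pcont l)).
  rewrite (_ : (fun m => P _) = series (fun k => p.2 k *: y k)) //.
  apply/funext => m; rewrite seriesEord /= linear_sum.
  by apply: eq_bigr => k _; rewrite linearZ /= Py.
rewrite [hull_map _ _ _]/hull_map -/l linearD linearZ /= Pe scaler0 add0r Pl => lE.
have pE k : p.2 k = (k == n)%:R.
  apply/eqP; rewrite -subr_eq0; apply/eqP.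
  (* Differences of coefficients are bounded by 2, not by 1. *)
  apply: (yfree (fun k => p.2 k - (k == n)%:R) 2) => [j|].
    rewrite (le_trans (ler_normB _ _)) // -[leRHS]/(1 + 1) lerD //.
      exact: (hull_coefs_bound pK).2.
    by rewrite normr_nat lern1 leq_b1.
  rewrite -(subrr (y n)) -{1}lE.
  have -> : series (fun k => (p.2 k - (k == n)%:R) *: y k) =
      (series (fun k => p.2 k *: y k)) - (series (fun k => (k == n)%:R *: y k)).
    apply/funext => m; rewrite !fctE !seriesEord /= -sumrB.
    by apply: eq_bigr => k' _; rewrite scalerBl.
  by apply: cvgB => //; exact: unit_series_cvg.
by rewrite (hull_coefs_unit_uniq pK pE) scale1r lE.
Qed.

Lemma symmetric_convex_inner0 {R : realType} {E : lmodType R} (A : set E) :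
  A 0 -> (forall x, A x -> A (- x)) -> inner_point A 0.
Proof.
move=> A0 AN; split=> // x Ax x0; exists (- x); first exact: AN.
split; last by move=> /esym/eqP; rewrite oppr_eq0 => /eqP.
exists 2^-1; first lra.
by rewrite scalerN -scalerBl (_ : 1 - 2^-1 - 2^-1 = 0) ?scale0r //; lra.
Qed.

Theorem theorem2p4 (R : realType) (Z : completeNormedModType R)
    (hZ : infinite_dim [set: Z])
    (P : {linear Z -> Z}) (hPcont : continuous P) (hPproj : P \o P =1 P)
    (hPker : has_dim 1 (ker P)) :
  exists (C : set Z) (z : Z),
    [/\ convex_set C, compact C, infinite_dim_convex C & inner_point C z] /\
    ~ open_at C P z /\
    (forall U : set Z, open_nbhs (P z) U ->
       ~ exists s : Z -> Z, continuous_selection (U `&` P @` C) C P s).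
Proof.
have [y0 y0P y0free] := infinite_dim_has_free_seq (infinite_dim_range hZ hPproj hPker).
have [lam [lam0 ysmall yfree]] := bounded_free_scaling y0free.
pose y k := lam k *: y0 k.
have [e Pe e0] : exists2 e, P e = 0 & e != 0.
  have [f ffree kerE] := hPker; exists (f ord0).
    have : lspan f (f ord0) by exists (fun=> 1); rewrite big_ord1 scale1r.
    by rewrite -kerE.
  apply/eqP => f0; have := ffree (fun=> 1) _ ord0.
  by rewrite big_ord1 f0 scaler0 => /(_ erefl)/eqP; rewrite oner_eq0.
have Py k : P (y k) = y k.
  rewrite linearZ /=; congr (_ *: _); have [x _ <-] := y0P k.
  by rewrite -[P (P x)]/((P \o P) x) hPproj.
pose C := hull_map e y @` @hull_coefs R.
have Ccomb s t a b : C a -> C b -> `|s| + `|t| <= 1 -> C (s *: a + t *: b).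
  move=> [p pK <-] [q qK <-] st; rewrite -(hull_map_comb e ysmall s t pK qK).
  by exists (comb_coefs s t p q) => //; exact: hull_coefs_comb.
have Cpole : C e.
  by rewrite -[e](hull_map_pole e y); eexists; [exact: hull_coefs_pole|].
have Cunit n : C (e + y n).
  by rewrite -(hull_map_unit e y); eexists; [exact: hull_coefs_unit|].
have CN a : C a -> C (- a).
  move=> Ca; have := Ccomb (-1) 0 a a Ca Ca.
  by rewrite scaleN1r scale0r addr0; apply; rewrite normrN normr1 normr0 addr0.
have C0 : C 0.
  have := Ccomb 0 0 e e Cpole Cpole.
  by rewrite !scale0r addr0; apply; rewrite normr0 addr0.
have fibre := hull_fibre_over_unit hPcont Pe Py ysmall yfree.
have PCy n : (P @` C) (y n).
  by exists (e + y n) => //; rewrite linearD Pe Py add0r.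
have y_to0 : y n @[n --> \oo] --> 0.
  apply: norm_cvg0; apply: (@squeeze_cvgr _ _ _ _ (fun=> 0) (fun n => 2^-1 ^+ n)).
  - apply: nearW => n; rewrite normr_ge0 (le_trans (ysmall n)) //= exprS.
    by rewrite ler_piMl ?exprn_ge0 //; lra.
  - exact: cvg_cst.
  - by apply: cvg_expr; rewrite ger0_norm; lra.
exists C, 0; split; first split.
- move=> a b t; rewrite !inE => Ca Cb.
  apply: (Ccomb t%:num (1 - t%:num) a b Ca Cb).
  have t0 : 0 <= t%:num by [].
  have t1 : t%:num <= 1 by [].
  by rewrite !ger0_norm //; lra.
- apply: continuous_compact; last exact: hull_coefs_compact.
  exact: hull_map_continuous.
- have yindep n : lin_indep (fun i : 'I_n => y i).
    move=> a a0 i; apply/eqP.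
    have : a i * lam i == 0.
      apply/eqP; apply: (y0free n (fun i => a i * lam i)); rewrite -[RHS]a0.
      by apply: eq_bigr => j _; rewrite scalerA.
    by rewrite mulf_eq0 [X in _ || X]gt_eqF ?orbF.
  apply: (infinite_dim_free_seq yindep) => k.
  exists (e + y k); first by move=> A [_]; apply; exact: Cunit.
  by exists e; [move=> A [_]; apply | rewrite addrC addKr].
- exact: symmetric_convex_inner0.
split.
  move=> Copen; pose V := C `&` [set x | `|x| < `|e| / 2].
  have e2 : 0 < `|e| / 2 by rewrite divr_gt0 ?normr_gt0.
  have near0 : \forall x \near (0 : Z), `|x| < `|e| / 2 by exact: nbhs0_lt.
  have nbhsV : within C (nbhs 0) V.
    by apply: filterS near0 => x xlt Cx.
  have := Copen V (fun x => @proj1 _ _) nbhsV; rewrite linear0 /within /= => nbhsPV.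
  have Vy : \forall n \near \oo, (P @` C) (y n) -> (P @` V) (y n) by exact: (y_to0 _ nbhsPV).
  have ylt : \forall n \near \oo, `|y n| < `|e| / 2.
    exact: (y_to0 _ near0).
  have [n [Vn {}ylt]] := filter_ex (filterI Vy ylt).
  have [x [Cx xlt] Px] := Vn (PCy n).
  (* A preimage of [y n] in [V] is [e + y n], too far from 0. *)
  have := ler_normB (e + y n) (y n); rewrite addrK -(fibre n x Cx Px).
  move: xlt ylt => /=; lra.
rewrite linear0 => U [Uopen U0] [s [scont sC Ps]].
(* Along a sequence with one-point fibres, the selection has to follow the
   fibres. *)
have s0E (w v : nat -> Z) l : w @ \oo --> 0 -> v @ \oo --> l ->
    (forall n, (P @` C) (w n)) -> (forall n x, C x -> P x = w n -> x = v n) -> s 0 = l.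
  move=> w0 vl PCw wv.
  have Dw : \forall n \near \oo, (U `&` P @` C) (w n).
    have : \forall n \near \oo, U (w n) by apply: w0; exact: open_nbhs_nbhs.
    by apply: filterS => n Uw.
  have wwithin : w @ \oo --> within (U `&` P @` C) (nbhs 0).
    move=> A wA; have {}wA : \forall n \near \oo, (U `&` P @` C) (w n) -> A (w n).
      exact: (w0 _ wA).
    by apply: filterS2 Dw wA => n Dn /(_ Dn).
  have D0 : (U `&` P @` C) 0 by split=> //; exists 0; rewrite ?linear0.
  have sw := cvg_comp _ _ wwithin ((subspace_continuousP _ _).1 scont 0 D0).
  apply: (cvg_unique (@norm_hausdorff _ Z) sw).
  apply: (cvg_trans _ vl); apply: near_eq_cvg.
  apply: filterS Dw => n Dn; apply/esym/(wv n); [exact: sC | exact: Ps].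
have xe : e + y n @[n --> \oo] --> e.
  by rewrite -[X in _ --> X]addr0; apply: cvgD => //; exact: cvg_cst.
have s0e : s 0 = e by apply: s0E y_to0 xe PCy fibre.
have s0Ne : s 0 = - e.
  apply: (s0E (fun n => - y n) (fun n => - (e + y n))).
  - by rewrite -[X in _ --> X]oppr0; exact: cvgN.
  - exact: cvgN.
  - by move=> n; have [x Cx <-] := PCy n; exists (- x); [exact: CN | rewrite linearN].
  - move=> n x Cx Px; rewrite -(fibre n (- x)) ?opprK //; first exact: CN.
    by rewrite linearN Px opprK.
have : e + e = 0 by rewrite -{1}s0e s0Ne addNr.
rewrite -mulr2n -scaler_nat => /eqP; rewrite scaler_eq0 (negPf e0) orbF.
by rewrite pnatr_eq0.
Qed.
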